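(* Let $x=(x_n)_{n\in\mathbb{N}}$ be a sequence in $[0,1]$ and let $0<\varepsilon<1$ be such that $D_N(x)=o(N^{-(1-\varepsilon)})$ as $N\to\infty$. Then, for every integer $k\ge 2$, the sequence has $(k,\beta)$-Poissonian box correlations for all $0<\beta\leq 1-\varepsilon$.
   Context: $D_N(x)$ denotes the discrepancy of the first $N$ points, $D_N(x)=\sup_{0\le a<b\le 1}\left|\frac{1}{N}\#\{1\le i\le N: x_i\in[a,b)\}-(b-a)\right|$. $\Vert x\Vert=\min_{z\in\mathbb{Z}}|x-z|$. For $\beta\in(0,1]$, $k\ge2$ and $s_1,\ldots,s_{k-1}>0$ define \[ R_{k,\beta}(s_1,\ldots,s_{k-1},N)=\frac{\#\{(i_1,\ldots,i_k): 1\le i_1,\ldots,i_k\le N\text{ distinct},\ \Vert x_{i_l}-x_{i_k}\Vert\le s_l/N^\beta \text{ for } l=1,\ldots,k-1\}}{N^{k-(k-1)\beta}}. \] The sequence has $(k,\beta)$-Poissonian box correlations if $\lim_{N\to\infty}R_{k,\beta}(s_1,\ldots,s_{k-1},N)=\prod_{l=1}^{k-1}2s_l$ for all $s_1,\ldots,s_{k-1}>0$. *)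

(* Defs.v *)
From mathcomp Require Import all_boot all_order all_algebra.
From mathcomp Require Import all_classical all_reals all_analysis.

Set Implicit Arguments.
Unset Strict Implicit.
Unset Printing Implicit Defensive.

Import Order.TTheory GRing.Theory Num.Theory.
Import numFieldNormedType.Exports.

Local Open Scope classical_set_scope.
Local Open Scope ring_scope.

(* Sequences are indexed from 0: [x i] is the (i+1)-st point of the sequence, *)
(* so the first N points are the [x i] with [i : 'I_N].                       *)

Definition local_discrepancy (R : realType) (x : nat -> R) (N : nat) (a b : R) : R :=
  `| #|[pred i : 'I_N | a <= x i < b]|%:R / N%:R - (b - a) |.

Definition discrepancy_values (R : realType) (x : nat -> R) (N : nat) : set R :=
  [set r | exists a b : R,
     [/\ 0 <= a, a < b, b <= 1 & r = local_discrepancy x N a b]].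

Definition discrepancy (R : realType) (x : nat -> R) (N : nat) : R :=
  sup (discrepancy_values x N).

(* [sup] is the junk value 0 on unbounded or empty sets; neither occurs here. *)
Lemma has_sup_discrepancy_values (R : realType) (x : nat -> R) (N : nat) :
  has_sup (discrepancy_values x N).
Proof.
split; first by exists (local_discrepancy x N 0 1), 0, 1; split.
exists 1 => _ [a [b [a0 ab b1 ->]]]; rewrite /local_discrepancy ler_norml.
set c := (_ / _); have c0 : 0 <= c by rewrite divr_ge0.
have c1 : c <= 1.
  rewrite /c; case: N {c c0} => [|N]; first by rewrite invr0 mulr0.
  rewrite ler_pdivrMr ?ltr0n// mul1r ler_nat.
  by rewrite (leq_trans (max_card _))// card_ord.
have ba1 : b - a <= 1 by rewrite lerBlDr (le_trans b1)// lerDl.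
have ba0 : 0 <= b - a by rewrite subr_ge0 ltW.
apply/andP; split; first by rewrite lerBrDr (le_trans _ c0)// addrC subr_le0.
by rewrite lerBlDr (le_trans c1)// lerDl.
Qed.

Definition dist_int (R : realType) (x : R) : R :=
  inf [set `|x - z%:~R| | z in [set: int]].

(* The infimum is a minimum. *)
Lemma dist_int_min (R : realType) (x : R) :
  (exists z : int, dist_int x = `|x - z%:~R|) /\
  (forall z : int, dist_int x <= `|x - z%:~R|).
Proof.
set A := [set `|x - z%:~R| | z in [set: int]].
have lbA : has_lbound A by exists 0 => _ [z _ <-].
split=> [|z]; last by apply: ge_inf => //; exists z.
pose f := Num.floor x; pose y := x - f%:~R.
have y0 : 0 <= y by rewrite subr_ge0 floor_le.
have y1 : y < 1.
  by rewrite ltrBlDr addrC -[1]/(1%:~R) -intrD floorD1_gt.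
have key z : Num.min y (1 - y) <= `|x - z%:~R|.
  rewrite ge_min; case: (leP z f) => zf.
    apply/orP; left; rewrite (le_trans _ (ler_norm _))// lerD2l lerN2.
    by rewrite ler_int.
  apply/orP; right; rewrite distrC (le_trans _ (ler_norm _))//.
  rewrite opprB addrC -addrA [- x + _]addrC addrA lerD2r.
  by rewrite -[1]/(1%:~R) -intrD ler_int lezD1.
have [z zE] : exists z : int, Num.min y (1 - y) = `|x - z%:~R|.
  rewrite minEle; case: ifP => _; first by exists f; rewrite ger0_norm.
  exists (f + 1); have -> : x - (f + 1)%:~R = - (1 - y).
    by rewrite intrD opprD addrA opprB.
  by rewrite normrN ger0_norm// subr_ge0 ltW.
exists z; apply/eqP; rewrite eq_le; apply/andP; split.
  by apply: ge_inf => //; exists z.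
by rewrite -zE; apply: lb_le_inf => [|_ [w _ <-]]; [exists `|x - 0%:~R|, 0|].
Qed.

(* A k-tuple of indices is a function on ['I_k.-1.+1], which is ['I_k] for    *)
(* k > 0; its k-th entry is the one at [ord_max], and the l-th entry for      *)
(* l < k is the one at [l : 'I_k.-1] widened to ['I_k.-1.+1].                 *)
Definition box_count (R : realType) (x : nat -> R) (k : nat) (beta : R)
    (s : 'I_k.-1 -> R) (N : nat) : nat :=
  #|[pred i : {ffun 'I_k.-1.+1 -> 'I_N} | injectiveb i &&
      [forall l : 'I_k.-1,
         dist_int (x (i (widen_ord (leqnSn k.-1) l)) - x (i ord_max))
           <= s l / N%:R `^ beta]]|.

Definition box_correlation (R : realType) (x : nat -> R) (k : nat) (beta : R)
    (s : 'I_k.-1 -> R) (N : nat) : R :=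
  (box_count x beta s N)%:R / N%:R `^ (k%:R - k.-1%:R * beta).

Definition poissonian_box_correlations (R : realType) (x : nat -> R)
    (k : nat) (beta : R) : Prop :=
  forall s : 'I_k.-1 -> R, (forall l, 0 < s l) ->
    box_correlation x beta s N @[N --> \oo] --> \prod_(l < k.-1) (2 * s l).

(* Main.v *)
Require Import Defs.
From mathcomp Require Import all_boot all_order all_algebra.
From mathcomp Require Import all_classical all_reals all_analysis.
From mathcomp Require Import ring lra.

Set Implicit Arguments.
Unset Strict Implicit.
Unset Printing Implicit Defensive.

Import Order.TTheory GRing.Theory Num.Theory.
Import numFieldNormedType.Exports.

Local Open Scope classical_set_scope.
Local Open Scope ring_scope.

(* Every arc of length l of the circle R/Z contains at least N l - 2 N D_N of  *)
(* the first N points. Applied to the ball of radius s/N^beta around x_j and   *)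
(* to an arc inside its complement, this shows that the ball contains          *)
(* 2 s N^(1-beta) + O(N D_N + 1) points uniformly in j, and the error is       *)
(* o(N^(1-beta)) as beta <= 1 - eps. For a fixed last index j, tuples that may *)
(* have equal entries range over a product of balls, and those with two equal  *)
(* entries are fewer by a factor of order N^(1-beta), which tends to infinity. *)
(* Summing over j squeezes the correlation function.                           *)

(** Write M for N^(1-beta). [card_ball_bounds] puts between M (2 s_l - e) and M (2 s_l + e) points
    in each ball, where M e = 2 N D_N + 1. For a fixed last index the tuples form a product of
    balls, and [card_family_injective_ge] bounds the share with repeated entries by q = k^2 / (M
    sigma), sigma being a lower bound of the s_l. The normalisation is exactly N M^(k-1), so
    [box_correlation_bounds] traps the correlation, for each large N, between (1 - q) times the
    product of the 2 s_l - e and the product of the 2 s_l + e. Both e and q tend to 0: N^beta D_N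
    does by hypothesis, as beta <= 1 - eps, and 1/M does because beta < 1. *)

Lemma card_family_prod (aT T : finType) (F : aT -> pred T) :
  (#|family F| = \prod_l #|F l|)%N.
Proof. by rewrite card_family foldrE big_map big_enum. Qed.

(* Overwriting the value at [a] by an arbitrary element of [F a] loses nothing: *)
(* the old value can be read off at [b].                                        *)
Lemma card_family_collision (aT T : finType) (F : aT -> pred T) (a b : aT) :
  a != b ->
  (#|[pred f in family F | f a == f b]| * #|F a| <= \prod_l #|F l|)%N.
Proof.
move=> ab; rewrite -card_family_prod.
rewrite -(cardsE [pred f in family F | f a == f b]) -(cardsE (F a)) -cardsX.
pose h (u : {ffun aT -> T} * T) := [ffun l => if l == a then u.2 else u.1 l].
rewrite -(card_in_imset (f := h)); last first.
  move=> [f t] [g w]; rewrite !inE /= => /andP[/andP[_ /eqP fab] _].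
  move=> /andP[/andP[_ /eqP gab] _] /ffunP hE.
  have tw : t = w by have := hE a; rewrite !ffunE eqxx.
  have fg l : l != a -> f l = g l.
    by move=> /negPf la; have := hE l; rewrite !ffunE la.
  congr pair => //; apply/ffunP => l; have [->|/fg//] := eqVneq l a.
  by rewrite fab gab fg// eq_sym.
apply: subset_leq_card; apply/fintype.subsetP => _ /imsetP[[f t] + ->].
rewrite !inE /= => /andP[/andP[/forallP fF _] tF]; apply/forallP => l.
by rewrite ffunE; case: eqP => [->|].
Qed.

(** Union bound over the pairs a < b at which a non-injective f coincides. The smaller index a is
    never [ord_max], so its factor has at least t elements and [card_family_collision] applies. The
    last factor is exempt from the hypothesis because it will be a singleton. *)
Lemma card_family_injective_ge (R : realDomainType) (n : nat) (T : finType)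
    (F : 'I_n.+1 -> pred T) (t : R) :
  (forall a : 'I_n.+1, a != ord_max -> t <= #|F a|%:R) ->
  t * ((\prod_l #|F l|)%:R - #|[pred f in family F | injectiveb f]|%:R) <=
  (n.+1 ^ 2 * \prod_l #|F l|)%:R.
Proof.
move=> tF.
pose E (p : 'I_n.+1 * 'I_n.+1) := [pred f in family F | f p.1 == f p.2].
have split_card : (\prod_l #|F l| <= #|[pred f in family F | injectiveb f]| +
    \sum_(p : 'I_n.+1 * 'I_n.+1 | (p.1 < p.2)%N) #|E p|)%N.
  rewrite -card_family_prod.
  rewrite -(cardID [pred f : {ffun 'I_n.+1 -> T} | injectiveb f] (family F)).
  apply: leq_add; first by apply: eq_leq; apply: eq_card => f; rewrite !inE.
  rewrite -sum1_card; under [leqRHS]eq_bigr do rewrite -sum1_card big_mkcond.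
  rewrite exchange_big/= [leqLHS]big_mkcond; apply: leq_sum => f _.
  rewrite !inE; case: ifP => // /andP[/injectivePn[a [b ab fab]] fF].
  wlog lab : a b ab fab / (a < b)%N.
    move=> hw; case: (ltngtP a b) => [| |/val_inj /eqP]; last by rewrite (negPf ab).
      exact: hw.
    by apply: hw; rewrite // eq_sym.
  by rewrite (bigD1 (a, b))//= !inE/= fF fab eqxx.
have [t0|t0] := leP 0 t; last first.
  rewrite (@le_trans _ _ 0)// mulr_le0_ge0 ?(ltW t0)// subr_ge0 ler_nat -card_family_prod.
  by apply: subset_leq_card; apply/fintype.subsetP => f; rewrite !inE => /andP[].
have tE (p : 'I_n.+1 * 'I_n.+1) : (p.1 < p.2)%N -> t * #|E p|%:R <= (\prod_l #|F l|)%:R.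
  move=> lp; have p1 : p.1 != ord_max.
    by apply: contraTneq lp => ->; rewrite -leqNgt leq_ord.
  apply: (@le_trans _ _ (#|E p| * #|F p.1|)%:R).
    by rewrite natrM mulrC ler_wpM2l// tF.
  by rewrite ler_nat; apply: card_family_collision; rewrite neq_ltn lp.
apply: (@le_trans _ _ (t * \sum_(p : 'I_n.+1 * 'I_n.+1 | (p.1 < p.2)%N) #|E p|%:R)).
  by rewrite ler_wpM2l// lerBlDl -natr_sum -natrD ler_nat.
rewrite mulr_sumr (le_trans (ler_sum _ tE))// sumr_const -mulrnA mulnC.
rewrite ler_nat leq_mul2r; apply/orP; right.
by rewrite (leq_trans (max_card _))// card_prod card_ord.
Qed.

(** * From discrepancy to the number of points in a ball *)

Lemma local_discrepancy_le (R : realType) (x : nat -> R) (N : nat) (a b : R) :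
  0 <= a -> a < b -> b <= 1 -> local_discrepancy x N a b <= discrepancy x N.
Proof.
move=> a0 ab b1; apply: ub_le_sup; first by case: (has_sup_discrepancy_values x N).
by exists a, b; split.
Qed.

Lemma discrepancy_ge0 (R : realType) (x : nat -> R) (N : nat) :
  0 <= discrepancy x N.
Proof.
apply: le_trans (local_discrepancy_le x N (lexx 0) ltr01 (lexx 1)).
exact: normr_ge0.
Qed.

Lemma card_interval_ge (R : realType) (x : nat -> R) (N : nat) (a b : R) :
  0 <= a -> a <= b -> b <= 1 ->
  N%:R * (b - a) - N%:R * discrepancy x N <= #|[pred i : 'I_N | a <= x i < b]|%:R.
Proof.
move=> a0; rewrite le_eqVlt => /predU1P[<- _|ab b1].
  rewrite subrr mulr0 sub0r (@le_trans _ _ 0)// oppr_le0.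
  by rewrite mulr_ge0// discrepancy_ge0.
have [->|N0] := posnP N; first by rewrite !mul0r subrr.
have N0' : 0 < N%:R :> R by rewrite ltr0n.
have := local_discrepancy_le x N a0 ab b1.
rewrite /local_discrepancy ler_norml => /andP[+ _].
rewrite lerBrDl -(ler_pM2l N0') mulrCA divff ?gt_eqF// mulr1.
by rewrite mulrDr mulrN.
Qed.

(* An arc of length [l] of the circle R/Z starting at [u] is, up to an integer *)
(* translation, one interval of [0, 1) or the union of two.                    *)
Lemma card_arc_ge (R : realType) (x : nat -> R) (N : nat) (u l : R) (P : pred R) :
  0 <= l -> l <= 1 ->
  (forall (y : R) (z : int), u + z%:~R <= y < u + l + z%:~R -> P y) ->
  N%:R * l - 2 * (N%:R * discrepancy x N) <= #|[pred i : 'I_N | P (x i)]|%:R.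
Proof.
move=> l0 l1 arcP; pose z := - Num.floor u; pose v := u + z%:~R.
have v0 : 0 <= v by rewrite /v rmorphN subr_ge0 floor_le.
have v1 : v < 1.
  by rewrite /v rmorphN ltrBlDr addrC -[1]/(1%:~R) -intrD floorD1_gt.
have ND0 : 0 <= N%:R * discrepancy x N by rewrite mulr_ge0// discrepancy_ge0.
have [vl|vl] := leP (v + l) 1.
  have /(card_interval_ge x N v0)/(_ vl) : v <= v + l by rewrite lerDl.
  set A := #|_| => hA; apply: (@le_trans _ _ A%:R); first lra.
  rewrite ler_nat; apply: subset_leq_card; apply/fintype.subsetP => i.
  rewrite !inE => /andP[xi1 xi2]; apply: (arcP _ z).
  by move: xi1 xi2; rewrite /v => *; apply/andP; split; lra.
(* The arc passes 1: [A] is the piece before 1, [B] the rest moved back by 1, hence the translation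
   by z - 1 below. They are disjoint because l <= 1. *)
pose A := [pred i : 'I_N | v <= x i < 1].
pose B := [pred i : 'I_N | 0 <= x i < v + l - 1].
have disj : #|[predU A & B]| = (#|A| + #|B|)%N.
  apply/eqP; rewrite -cardUI.
  rewrite [#|[predI A & B]|]eq_card0 ?addn0// => i; rewrite !inE.
  by apply/negP => /andP[/andP[? _] /andP[_ ?]]; lra.
apply: (@le_trans _ _ (#|A| + #|B|)%:R); last first.
  rewrite -disj ler_nat; apply: subset_leq_card; apply/fintype.subsetP => i.
  rewrite !inE => /orP[] /andP[xi1 xi2].
    by apply: (arcP _ z); move: xi1 xi2 vl; rewrite /v => *; apply/andP; split; lra.
  apply: (arcP _ (z - 1)); rewrite intrD.
  by move: xi1 xi2 v1; rewrite /v => *; apply/andP; split; lra.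
have hA := card_interval_ge x N v0 (ltW v1) (lexx 1).
have hB : N%:R * (v + l - 1 - 0) - N%:R * discrepancy x N <= #|B|%:R.
  by apply: card_interval_ge; lra.
rewrite natrD; move: hA hB; rewrite -/A -/B; lra.
Qed.

(** The ball contains an arc of length 2 r, which gives the lower bound; the upper bound comes from
    an arc inside the complement. *)
Lemma card_ball_bounds (R : realType) (x : nat -> R) (N : nat) (y r : R) :
  (0 < N)%N -> 0 < r -> 2 * r + N%:R^-1 <= 1 ->
  N%:R * (2 * r) - (2 * (N%:R * discrepancy x N) + 1) <=
    #|[pred i : 'I_N | dist_int (x i - y) <= r]|%:R <=
  N%:R * (2 * r) + (2 * (N%:R * discrepancy x N) + 1).
Proof.
move=> N0 r0 r1; have N0' : 0 < N%:R :> R by rewrite ltr0n.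
have V0 : 0 < N%:R^-1 :> R by rewrite invr_gt0.
have NV : N%:R * N%:R^-1 = 1 :> R by rewrite divff// gt_eqF.
apply/andP; split.
  have := @card_arc_ge R x N (y - r) (2 * r) (fun w => dist_int (w - y) <= r).
  move=> /(_ _ _ _)/le_trans => H.
  apply: (le_trans _ (H _ _ _ _ (lexx _))); [lra|lra|lra|].
  move=> w z /andP[h1 h2]; have [_ /(_ z) hz] := dist_int_min (w - y).
  by apply: (le_trans hz); rewrite ler_norml; apply/andP; split; lra.
(* The ball is closed and arcs contain their left end, so the complementary arc has to start
   strictly beyond y + r. A gap of 1/N costs N * (1/N) = 1 in the count, the summand 1 of the
   error. *)
have := @card_arc_ge R x N (y + r + N%:R^-1) (1 - 2 * r - N%:R^-1)
  (fun w => ~~ (dist_int (w - y) <= r)).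
pose c := #|[pred i : 'I_N | dist_int (x i - y) <= r]|; rewrite -/c.
set c' := #|[pred i : 'I_N | ~~ _]|.
have cN : c%:R + c'%:R = N%:R :> R.
  rewrite -natrD -[in RHS](card_ord N).
  by rewrite -[in RHS](cardC [pred i : 'I_N | dist_int (x i - y) <= r]).
move=> H.
have : N%:R * (1 - 2 * r - N%:R^-1) - 2 * (N%:R * discrepancy x N) <= c'%:R :> R.
  apply: H; [lra|lra|move=> w z /andP[h1 h2]].
  (* On the arc, w - y lies strictly between z + r and z + 1 - r, so it is farther than r from any
     integer k, whether k <= z or k >= z + 1. *)
  rewrite -ltNge; have [[k ->] _] := dist_int_min (w - y).
  have [kz|kz] := leP k z.
    have : k%:~R <= z%:~R :> R by rewrite ler_int.
    by move=> ?; rewrite (lt_le_trans _ (ler_norm _))//; lra.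
  have : z%:~R + 1 <= k%:~R :> R.
    by rewrite -[1]/(1%:~R) -intrD ler_int lezD1.
  by move=> ?; rewrite distrC (lt_le_trans _ (ler_norm _))//; lra.
rewrite !mulrBr mulr1 NV -cN; lra.
Qed.

(** * Splitting the tuples by their last index *)

(** Pinning the last coordinate by the singleton of j turns the tuples ending in j, repetitions
    allowed, into a full product, to which the counting lemmas for [family] apply. *)
Definition box_fibre (R : realType) (x : nat -> R) (k : nat) (beta : R)
    (s : 'I_k.-1 -> R) (N : nat) (j : 'I_N) (l : 'I_k.-1.+1) : pred 'I_N :=
  if unlift ord_max l is Some l'
  then [pred i : 'I_N | dist_int (x i - x j) <= s l' / N%:R `^ beta] else pred1 j.

Lemma box_countE (R : realType) (x : nat -> R) (k : nat) (beta : R)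
    (s : 'I_k.-1 -> R) (N : nat) :
  box_count x beta s N =
  (\sum_(j < N)
    #|[pred f in family (box_fibre x beta s j) | injectiveb f]|)%N.
Proof.
rewrite /box_count -sum1_card.
rewrite (partition_big (fun f : {ffun 'I_k.-1.+1 -> 'I_N} => f ord_max) xpredT)//=.
apply: eq_bigr => j _; rewrite -sum1_card; apply: eq_bigl => f.
have lastE i : (i \in box_fibre x beta s j ord_max) = (i == j).
  by rewrite -[LHS]/(box_fibre x beta s j ord_max i) /box_fibre unlift_none.
have liftE i l : (i \in box_fibre x beta s j (lift ord_max l)) =
    (dist_int (x i - x j) <= s l / N%:R `^ beta).
  by rewrite -[LHS]/(box_fibre x beta s j (lift ord_max l) i) /box_fibre liftK.
have widenE (l : 'I_k.-1) : widen_ord (leqnSn k.-1) l = lift ord_max l.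
  by apply: val_inj; exact/esym/lift_max.
apply/idP/idP => [/andP[/andP[finj /forallP fl] /eqP fj]|/andP[/familyP fF finj]].
  apply/andP; split=> //; apply/familyP => l.
  case: (unliftP ord_max l) => [l' ->|->]; last by rewrite lastE fj.
  by rewrite liftE -fj -widenE.
have fj : f ord_max == j by rewrite -lastE.
apply/andP; split=> //; apply/andP; split=> //; apply/forallP => l.
by rewrite widenE (eqP fj) -liftE.
Qed.

Lemma prod_card_box_fibre (R : realType) (x : nat -> R) (k : nat) (beta : R)
    (s : 'I_k.-1 -> R) (N : nat) (j : 'I_N) :
  (\prod_l #|box_fibre x beta s j l| =
   \prod_(l < k.-1)
     #|[pred i : 'I_N | (dist_int (x i - x j) <= s l / N%:R `^ beta)%R]|)%N.
Proof.
rewrite big_ord_recr /= [X in (_ * X)%N](_ : _ = 1%N) ?muln1; last first.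
  by rewrite /box_fibre unlift_none card1.
apply: eq_bigr => l _; have -> : widen_ord (leqnSn k.-1) l = lift ord_max l.
  by apply: val_inj; exact/esym/lift_max.
by rewrite /box_fibre liftK.
Qed.

(** * Finite bounds and passage to the limit *)

Lemma cvg_powR_natr (R : realType) (a : R) : 0 < a ->
  N%:R `^ a @[N --> \oo] --> (+oo : set_system R).
Proof.
move=> a0; apply/cvgryPge => A; near=> N.
(* A nonnegative bound is the a-th power of its a-th root, so it suffices that N exceeds this
   root. *)
have A1 : 0 <= Num.max A 0 by rewrite le_max lexx orbT.
rewrite (@le_trans _ _ (Num.max A 0))// ?le_max ?lexx//.
have -> : Num.max A 0 = (Num.max A 0 `^ a^-1) `^ a.
  by rewrite -powRrM mulVf ?gt_eqF// powRr1.
apply: ge0_ler_powR; rewrite ?nnegrE ?powR_ge0//; first exact: ltW.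
by near: N; exact: nbhs_infty_ger.
Unshelve. all: by end_near. Qed.

Lemma cvg_prodr (R : realType) (n : nat) (f : 'I_n -> nat -> R) (a : 'I_n -> R) :
  (forall l, f l N @[N --> \oo] --> a l) ->
  \prod_(l < n) f l N @[N --> \oo] --> \prod_(l < n) a l.
Proof.
by move=> fa; apply: (cvg_big (@mul_continuous R)) => l _; exact: fa.
Qed.

(** Here [M] is the order of magnitude of a ball count, [e] the error of that count divided by [M],
    and [q] bounds the proportion of tuples lost to coinciding entries. *)
Lemma box_correlation_bounds (R : realType) (x : nat -> R) (k : nat) (beta : R)
    (s : 'I_k.-1 -> R) (N : nat) (sigma : R) :
  let M := N%:R `^ (1 - beta) in
  let e := 2 * (N%:R `^ beta * discrepancy x N) + M^-1 in
  let q := (k.-1.+1 ^ 2)%:R * (M * sigma)^-1 in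
  (0 < k)%N -> (0 < N)%N -> 0 < sigma ->
  (forall l, sigma <= s l) -> (forall l, e <= s l) ->
  (forall l, 2 * (s l / N%:R `^ beta) + N%:R^-1 <= 1) -> q <= 1 ->
  (1 - q) * \prod_(l < k.-1) (2 * s l - e) <= box_correlation x beta s N <=
  \prod_(l < k.-1) (2 * s l + e).
Proof.
move=> M e q k0 N0 sigma0 sigmas es small q1.
have N0' : 0 < N%:R :> R by rewrite ltr0n.
have M0 : 0 < M by rewrite powR_gt0.
have Nb0 : 0 < N%:R `^ beta :> R by rewrite powR_gt0.
have MN : M * N%:R `^ beta = N%:R.
  by rewrite /M -powRD ?(gt_eqF N0') ?implybT// subrK powRr1// ltW.
have powE : N%:R `^ (k%:R - k.-1%:R * beta) = N%:R * M ^+ k.-1.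
  have -> : k%:R - k.-1%:R * beta = 1 + (1 - beta) * k.-1%:R :> R.
    by rewrite -{1}(prednK k0) -[in LHS]natr1; ring.
  rewrite powRD ?(gt_eqF N0') ?implybT// powRr1 ?(ltW N0')// powRrM -/M.
  by rewrite powR_mulrn// ltW.
have Me : M * e = 2 * (N%:R * discrepancy x N) + 1.
  by rewrite mulrDr divff ?gt_eqF// -[in RHS]MN; ring.
have NE a : N%:R * (2 * (a / N%:R `^ beta)) = M * (2 * a).
  by rewrite -{1}MN; field; rewrite gt_eqF.
pose c l (j : 'I_N) :=
  #|[pred i : 'I_N | dist_int (x i - x j) <= s l / N%:R `^ beta]|.
have cP l j : M * (2 * s l - e) <= (c l j)%:R <= M * (2 * s l + e).
  have sl0 : 0 < s l by exact: lt_le_trans (sigmas l).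
  have -> : M * (2 * s l - e) = N%:R * (2 * (s l / N%:R `^ beta)) - M * e.
    by rewrite NE; ring.
  have -> : M * (2 * s l + e) = N%:R * (2 * (s l / N%:R `^ beta)) + M * e.
    by rewrite NE; ring.
  by rewrite Me; apply: card_ball_bounds; rewrite ?divr_gt0.
have e0 : 0 <= e.
  by rewrite addr_ge0 ?invr_ge0 ?mulr_ge0 ?discrepancy_ge0 ?powR_ge0.
have prodM (f : 'I_k.-1 -> R) : \prod_l (M * f l) = M ^+ k.-1 * \prod_l f l.
  by rewrite big_split/= prodr_const card_ord.
pose inj (j : 'I_N) :=
  #|[pred f in family (box_fibre x beta s j) | injectiveb f]|.
have injP j : M ^+ k.-1 * ((1 - q) * \prod_l (2 * s l - e)) <= (inj j)%:R <=
    M ^+ k.-1 * \prod_l (2 * s l + e).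
  have prodE := prod_card_box_fibre x beta s j.
  apply/andP; split; last first.
    apply: (@le_trans _ _ (\prod_(l < k.-1) c l j)%:R).
      rewrite ler_nat -prodE -card_family_prod.
      by apply: subset_leq_card; apply/fintype.subsetP => f /andP[].
    rewrite natr_prod -prodM; apply: ler_prod => l _.
    by have /andP[_ ->] := cP l j; rewrite ler0n.
  apply: (@le_trans _ _ ((1 - q) * (\prod_(l < k.-1) c l j)%:R)).
    rewrite mulrCA ler_wpM2l ?subr_ge0// natr_prod -prodM.
    apply: ler_prod => l _; have /andP[-> _] := cP l j; rewrite andbT.
    rewrite mulr_ge0 ?(ltW M0)//; have := es l; have := sigmas l; lra.
  (* As e <= s_l and sigma <= s_l, a ball has at least M (2 s_l - e) >= M sigma points. *)
  have tl (a : 'I_k.-1.+1) : a != ord_max ->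
      M * sigma <= #|box_fibre x beta s j a|%:R.
    case: (unliftP ord_max a) => [l -> _|->]; last by rewrite eqxx.
    rewrite {1}/box_fibre liftK; have /andP[+ _] := cP l j.
    apply: le_trans; rewrite ler_wpM2l ?(ltW M0)//.
    by have := es l; have := sigmas l; lra.
  (* Dividing by M sigma, the number of non-injective tuples is at most q times the size of the
     product. *)
  have := card_family_injective_ge tl.
  rewrite prodE -/(inj j) natrM -ler_pdivlMl ?mulr_gt0// mulrA.
  rewrite [_^-1 * _]mulrC -/q; rewrite mulrBl mul1r; lra.
rewrite /box_correlation box_countE powE natr_sum -/inj.
have D0 : 0 < N%:R * M ^+ k.-1 by rewrite mulr_gt0// exprn_gt0.
have sumE (b : R) : b * (N%:R * M ^+ k.-1) = \sum_(j < N) M ^+ k.-1 * b.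
  by rewrite sumr_const card_ord -[RHS]mulr_natl; ring.
rewrite ler_pdivlMr// ler_pdivrMr// !sumE.
by apply/andP; split; apply: ler_sum => j _; have /andP[] := injP j.
Qed.

Lemma cvg_powR_discrepancy (R : realType) (x : nat -> R) (alpha beta : R) :
  discrepancy x =o_\oo (fun N : nat => N%:R `^ (- alpha)) -> beta <= alpha ->
  N%:R `^ beta * discrepancy x N @[N --> \oo] --> 0.
Proof.
move=> Dx ba; apply/cvgr0Pnorm_le => d d0.
move/eqoP: Dx => /(_ d d0) Dx; near=> N.
have N0 : (0 < N)%N by near: N; exact: nbhs_infty_gt.
have DN : `|discrepancy x N| <= d * `|N%:R `^ (- alpha)| by near: N.
rewrite normrM (ger0_norm (powR_ge0 _ _)).
have Nab : N%:R `^ beta <= N%:R `^ alpha :> R by rewrite ler_powR// ler1n.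
apply: (@le_trans _ _ (N%:R `^ alpha * (d * `|N%:R `^ (- alpha)|))).
  by rewrite ler_pM ?powR_ge0.
rewrite (ger0_norm (powR_ge0 _ _)) mulrCA powRN divff ?mulr1//.
by rewrite gt_eqF// powR_gt0// ltr0n.
Unshelve. all: by end_near. Qed.

Theorem theorem1p7 (R : realType) (x : nat -> R)
    (x01 : forall n : nat, 0 <= x n <= 1)
    (eps : R) (eps_gt0 : 0 < eps) (eps_lt1 : eps < 1)
    (Dx : discrepancy x =o_\oo (fun N : nat => N%:R `^ (- (1 - eps)))) :
  forall k : nat, (2 <= k)%N ->
  forall beta : R, 0 < beta -> beta <= 1 - eps ->
  poissonian_box_correlations x k beta.
Proof.
move=> k k2 beta beta0 betale s s0.
pose M N : R := N%:R `^ (1 - beta).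
pose e N := 2 * (N%:R `^ beta * discrepancy x N) + (M N)^-1.
(* One positive lower bound for all s_l; the default 1 keeps it positive. *)
pose sigma := \big[Num.min/1]_l s l.
pose q N := (k.-1.+1 ^ 2)%:R * (M N * sigma)^-1.
have sigma0 : 0 < sigma by apply: lt_bigmin.
have cvgV (a : R) : 0 < a -> (N%:R `^ a)^-1 @[N --> \oo] --> (0 : R).
  move=> a0; apply/gtr0_cvgV0; last exact: cvg_powR_natr.
  by near=> N; rewrite powR_gt0// ltr0n; near: N; exact: nbhs_infty_gt.
(* The exponent 1 - beta is positive because beta <= 1 - eps and eps > 0. *)
have cvgMV : (M N)^-1 @[N --> \oo] --> 0 by apply: cvgV; lra.
have cvg_e : e N @[N --> \oo] --> 0.
  rewrite -[0]addr0; apply: cvgD => //; rewrite -[0](mulr0 2).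
  by apply: cvgMr; exact: (cvg_powR_discrepancy Dx).
have cvg_q : q N @[N --> \oo] --> 0.
  rewrite (_ : q = fun N => (k.-1.+1 ^ 2)%:R * sigma^-1 * (M N)^-1).
    by rewrite -[0](mulr0 ((k.-1.+1 ^ 2)%:R * sigma^-1)); exact: cvgMr.
  by apply/funext => N; rewrite /q invfM; ring.
have cvg_small l : 2 * (s l / N%:R `^ beta) + N%:R^-1 @[N --> \oo] --> (0 : R).
  rewrite -[0]addr0; apply: cvgD; last first.
    by have := cvgV 1 ltr01; under eq_fun do rewrite powRr1//.
  under eq_fun do rewrite mulrA; rewrite -[0](mulr0 (2 * s l)).
  by apply: cvgMr; exact: cvgV.
have bounds : \forall N \near \oo,
    (1 - q N) * \prod_(l < k.-1) (2 * s l - e N) <= box_correlation x beta s N <=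
    \prod_(l < k.-1) (2 * s l + e N).
  (* There are finitely many l, so conditions that hold eventually for each l hold eventually for
     all at once. *)
  have near_e : \forall N \near \oo, forall l, e N <= s l.
    by apply: filter_forall => l; apply: cvgr_le cvg_e _ (s0 l).
  have near_small : \forall N \near \oo,
      forall l, 2 * (s l / N%:R `^ beta) + N%:R^-1 <= 1.
    by apply: filter_forall => l; apply: cvgr_le (cvg_small l) _ ltr01.
  near=> N; apply: (@box_correlation_bounds R x k beta s N sigma) => //.
  - exact: ltnW.
  - by near: N; exact: nbhs_infty_gt.
  - by move=> l; exact: bigmin_le.
  - by near: N.
  - by near: N.
  - by near: N; exact: cvgr_le cvg_q _ ltr01.
apply: (squeeze_cvgr bounds).
  have -> : \prod_(l < k.-1) (2 * s l) = (1 - 0) * \prod_(l < k.-1) (2 * s l).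
    by rewrite subr0 mul1r.
  apply: cvgM; first by apply: cvgB => //; exact: cvg_cst.
  apply: cvg_prodr => l; rewrite -[X in _ --> X]subr0.
  by apply: cvgB => //; exact: cvg_cst.
apply: cvg_prodr => l; rewrite -[X in _ --> X]addr0.
by apply: cvgD => //; exact: cvg_cst.
Unshelve. all: by end_near. Qed.
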